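(* Let $N \geq 1$, let $\alpha > 0$, let $w \in \mathbb{R}^N$ be a weight vector with non-negative entries, let $y \in \mathbb{T}^N$, and let $V = \mathrm{Val}(y) \cup \mathrm{Val}(\tilde y)$, where $\tilde y$ denotes the tuple of antipodal points of $y$. Then $$\min_{x \in \mathbb{T}^N} T_{\alpha;y}(x) = \min_{x \in V^N} T_{\alpha;y}(x).$$
   Context: $\mathbb{T} = \mathbb{S}^1$ is the unit circle and $d_{\mathbb{T}}(u,v)$ is the arc length distance of $u,v \in \mathbb{T}$ (so the circle has total length $2\pi$ and antipodal points are at distance $\pi$). For data $y = (y_1,\ldots,y_N) \in \mathbb{T}^N$, non-negative weights $w = (w_1,\ldots,w_N)$ and $\alpha > 0$, the $L^1$-TV functional is $$T_{\alpha;y}(x) = \alpha \sum_{n=1}^{N-1} d_{\mathbb{T}}(x_n, x_{n+1}) + \sum_{n=1}^{N} w_n\, d_{\mathbb{T}}(x_n, y_n), \qquad x \in \mathbb{T}^N.$$ For an $N$-tuple $y$, $\mathrm{Val}(y) = \{y_1,\ldots,y_N\}$ denotes its set of values. The tuple of antipodal points of $y$ is $\tilde y = (\tilde y_1,\ldots,\tilde y_N)$, where $\tilde y_n$ is the unique point of $\mathbb{T}$ with $d_{\mathbb{T}}(y_n,\tilde y_n) = \pi$. *)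

(* Defs.v *)
From HB Require Import structures.
From mathcomp Require Export all_boot all_order all_algebra.
From mathcomp Require Export all_classical all_reals all_analysis.
From mathcomp Require Export complex.
From mathcomp Require Import ring.

Set Implicit Arguments.
Unset Strict Implicit.
Unset Printing Implicit Defensive.

Import Order.TTheory GRing.Theory Num.Theory.
Local Open Scope classical_set_scope.
Local Open Scope ring_scope.
Local Open Scope complex_scope.

Definition circle (R : realType) : Type := {z : R[i] | `|z| == 1}.

(* The arc that starts at u and turns through the angle t (counterclockwise if
   t >= 0, clockwise otherwise) ends at u * e^(it) and has length |t|. *)
Definition arc_lengths (R : realType) (u v : circle R) : set R :=
  [set `|t| | t in [set t : R | val v = val u * (cos t +i* sin t)]].

Definition circle_dist (R : realType) (u v : circle R) : R :=
  inf (arc_lengths u v).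

Lemma antipode_subproof (R : realType) (u : circle R) : `|- val u| == 1.
Proof. by rewrite normrN (valP u). Qed.

(* This is the unique point at distance pi from u: see antipodeP. *)
Definition antipode (R : realType) (u : circle R) : circle R :=
  exist _ (- val u) (antipode_subproof u).

(* The first sum runs over the pairs (m, n) of indices with n = m + 1. *)
Definition L1TV (R : realType) (N : nat) (alpha : R) (w : 'I_N -> R)
    (y x : 'I_N -> circle R) : R :=
  alpha * (\sum_(m < N) \sum_(n < N | n == m.+1 :> nat) circle_dist (x m) (x n))
  + \sum_(n < N) w n * circle_dist (x n) (y n).

Definition Val (R : realType) (N : nat) (y : 'I_N -> circle R) :
  set (circle R) := range y.

(* "The minimum of f over A exists and equals m." *)
Definition is_min (R : realType) (X : Type) (A : set X) (f : X -> R) (m : R) :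
  Prop := (f @` A) m /\ lbound (f @` A) m.

Section circle_dist_theory.
Variable R : realType.
Implicit Types u v : circle R.

Lemma circle_sqr u : complex.Re (val u) ^+ 2 + complex.Im (val u) ^+ 2 = 1.
Proof.
have := add_Re2_Im2 (val u).
by have /eqP -> := valP u; rewrite expr1n => /(congr1 (@complex.Re R)).
Qed.

Lemma circle_dot_itv u v :
  -1 <= complex.Re (val u) * complex.Re (val v) +
    complex.Im (val u) * complex.Im (val v) <= 1.
Proof.
have := circle_sqr u; have := circle_sqr v.
case: (val u) (val v) => [a b] [c d] /= hv hu.
rewrite -ler_norml -(@ler_pXn2r _ 2) ?nnegrE//.
rewrite real_normK ?num_real// expr1n -subr_ge0.
suff -> : 1 - (a * c + b * d) ^+ 2 = (a * d - b * c) ^+ 2 by exact: sqr_ge0.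
have -> : 1 = (a ^+ 2 + b ^+ 2) * (c ^+ 2 + d ^+ 2) :> R by rewrite hu hv mulr1.
rewrite !expr2; ring.
Qed.

Lemma circle_distE u v :
  circle_dist u v = acos (complex.Re (val u) * complex.Re (val v) +
    complex.Im (val u) * complex.Im (val v)).
Proof.
have citv := circle_dot_itv u v.
have := circle_sqr u; have := circle_sqr v.
rewrite /circle_dist /arc_lengths.
move: citv; case: (val u) (val v) => [a b] [c d] /= citv hv hu.
set k := a * c + b * d in citv *; set s := a * d - b * c.
have k2s2 : k ^+ 2 + s ^+ 2 = 1.
  rewrite -[RHS](mulr1 1) -{1}hu -hv /k /s !expr2; ring.
have rotE t : (c +i* d = (a +i* b) * (cos t +i* sin t)) <->
    (cos t = k /\ sin t = s).
  split.
    case=> hc hd; split.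
      rewrite /k hc hd -[LHS]mul1r -hu !expr2; ring.
    rewrite /s hc hd -[LHS]mul1r -hu !expr2; ring.
  case=> hc hs; congr Complex; rewrite hc hs.
    rewrite -[LHS]mul1r -hu /k /s !expr2; ring.
  rewrite -[LHS]mul1r -hu /k /s !expr2; ring.
set S := (X in inf X).
have Slb : lbound S (acos k).
  move=> _ [t /= /rotE[tk _] <-].
  have [tpi|/ltW pit] := lerP `|t| pi.
    rewrite -tk -[cos t](_ : cos `|t| = _); last by case: ger0P => // _; rewrite cosN.
    by rewrite cosK// in_itv/= normr_ge0.
  by rewrite (le_trans _ pit)// acos_lepi.
have Sk : S (acos k).
  have cosk : cos (acos k) = k by rewrite acosK// in_itv.
  have sink : sin (acos k) = `|s|.
    by rewrite sin_acos// -sqrtr_sqr -k2s2 addrC addKr.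
  have [s0|s0] := ger0P s.
    by exists (acos k); [apply/rotE; rewrite sink ger0_norm|rewrite ger0_norm ?acos_ge0].
  exists (- acos k); last by rewrite normrN ger0_norm ?acos_ge0.
  by apply/rotE; rewrite cosN sinN sink ltr0_norm// opprK.
apply/eqP; rewrite eq_le; apply/andP; split.
  by apply: ge_inf => //; exists (acos k).
by apply: lb_le_inf => //; exists (acos k).
Qed.

Lemma antipodeP u v : circle_dist u v = pi <-> v = antipode u.
Proof.
have := circle_sqr u; have := circle_sqr v; have := circle_dot_itv u v.
have -> : v = antipode u <-> val v = - val u.
  by split=> [->//|h]; apply: val_inj.
rewrite circle_distE; case: (val u) (val v) => [a b] [c d] /= citv hv hu.
split; last first.
  case=> -> ->; rewrite !mulrN -opprD -!expr2 hu; exact: acosN1.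
move=> /(congr1 cos); rewrite acosK ?in_itv// cospi => h.
have : (a + c) ^+ 2 + (b + d) ^+ 2 = 0.
  transitivity ((a ^+ 2 + b ^+ 2) + (c ^+ 2 + d ^+ 2) + (a * c + b * d) *+ 2).
    rewrite !expr2; ring.
  rewrite hu hv h; ring.
move/eqP; rewrite paddr_eq0 ?sqr_ge0// !sqrf_eq0 !addr_eq0.
by move=> /andP[/eqP-> /eqP->]; congr Complex; rewrite opprK.
Qed.

End circle_dist_theory.

(* Main.v *)
Require Import Defs.
From HB Require Import structures.
From mathcomp Require Import ring lra.

Import Order.TTheory GRing.Theory Num.Theory.
Local Open Scope classical_set_scope.
Local Open Scope ring_scope.

(** The geometric fact behind the theorem is that the distance to a fixed point
    [u] is concave along every arc of the circle whose interior avoids [u] (it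
    is [min(t, 2 pi - t)] there).  Let [S] be a finite nonempty set of points
    and [a] any point, and let [b] and [c] be the first points of [S] met when
    leaving [a] in the two directions.  The arc from [b] to [c] through [a] has
    no point of [S] in its interior, so concavity gives weights [l] and [1 - l]
    that do not depend on [u], with
    [l * d(b, u) + (1 - l) * d(c, u) <= d(a, u)] for all [u] in [S]
    ([circle_dist_interpolation]).

    Let [a] be a value of [x], and let [S] contain the data and the other values
    of [x].  Moving all the entries of [x] equal to [a] together to [b], or
    all together to [c], keeps their mutual distances zero; averaging the two
    results with the weights [l] and [1 - l] does not increase any term of the
    functional, so one of the two moves does not increase the functional
    ([L1TV_remove_value]).  Removing the values of [x] one after another leaves
    only data values ([L1TV_reduce_to_data]).

    So every [x] is dominated by a tuple with entries in [Val y].  There are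
    finitely many of these; the best one is a minimizer over all tuples, and it
    lies in the restricted set, whence both minima exist and are equal. *)

HB.instance Definition _ (R : realType) :=
  Choice.copy (circle R) {z : R[i] | `|z| == 1}.

Lemma seq_argmin {R : realDomainType} {T : eqType} {S : seq T} (f : T -> R) :
  S != [::] -> exists2 b, b \in S & {in S, forall u, f b <= f u}.
Proof.
elim: S => // z [|z' S] IH _.
  by exists z; rewrite ?mem_head// => u; rewrite inE => /eqP ->.
have [//|b bS bmin] := IH.
have [zb|/ltW bz] := lerP (f z) (f b).
  exists z; first exact: mem_head.
  move=> u; rewrite inE => /predU1P[->//|/bmin]; exact: le_trans.
exists b; first by rewrite inE bS orbT.
by move=> u; rewrite inE => /predU1P[->//|/bmin].
Qed.

(** The weights of the barycentre 0 of the points [p] and [- r] of the line. *)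
Lemma barycentric_weight {F : realFieldType} {p r : F} : 0 <= p -> 0 < r ->
  exists2 l, 0 <= l <= 1 & l * p = (1 - l) * r.
Proof.
move=> p0 r0; have rp0 : 0 < r + p by rewrite ltr_wpDr.
exists (r / (r + p)); last by field; rewrite gt_eqF.
by rewrite divr_ge0 ?(ltW r0) ?(ltW rp0)// ler_pdivrMr// mul1r lerDl.
Qed.

Lemma barycentre_le {F : realFieldType} {l p r t B C : F} :
  0 <= l <= 1 -> l * p = (1 - l) * r -> B <= t - p -> C <= t + r ->
  l * B + (1 - l) * C <= t.
Proof.
move=> /andP[l0 l1] lE Bt Ct.
have -> : t = l * (t - p) + (1 - l) * (t + r).
  by transitivity (t - l * p + (1 - l) * r); [rewrite lE subrK|ring].
by apply: lerD; rewrite ler_wpM2l ?subr_ge0.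
Qed.

(** * Arcs and distances on the circle *)

Section Arcs.
Set Implicit Arguments.
Unset Strict Implicit.
Variable R : realType.
Implicit Types (u v a : circle R) (s t : R).

Definition rot t : R[i] := Complex (cos t) (sin t).

Lemma rotD s t : rot (s + t) = rot s * rot t.
Proof. by rewrite /rot cosD sinD; congr Complex; rewrite addrC. Qed.

Lemma rotD2pi t : rot (t + pi *+ 2) = rot t.
Proof. by rewrite /rot cosD2pi sinD2pi. Qed.

Lemma circle_dist_le_arc u v t :
  val v = val u * rot t -> circle_dist u v <= `|t|.
Proof.
by move=> uv; apply: ge_inf; [exists 0 => _ [r _ <-] | exists t].
Qed.

Lemma circle_distC u v : circle_dist u v = circle_dist v u.
Proof.
rewrite !circle_distE.
by rewrite [complex.Re (val u) * _]mulrC [complex.Im (val u) * _]mulrC.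
Qed.

Lemma circle_distxx u : circle_dist u u = 0.
Proof. by rewrite circle_distE -!expr2 circle_sqr acos1. Qed.

(** The scalar product of [u] and [v] determines the angle from [u] to [v] up to
    its sign, which is the sign of their cross product. *)
Lemma circle_dist_arc u v :
  exists t, [/\ val v = val u * rot t, circle_dist u v = `|t| & `|t| <= pi].
Proof.
have := circle_dot_itv u v; have := circle_sqr u; have := circle_sqr v.
rewrite circle_distE; case: (val u) (val v) => [a b] [c d] /= hv hu kitv.
set k := a * c + b * d in kitv *; set s := a * d - b * c.
have k2s2 : k ^+ 2 + s ^+ 2 = 1.
  by rewrite -[RHS](mulr1 1) -{1}hu -hv /k /s; ring.
have cosk : cos (acos k) = k by rewrite acosK// in_itv.
have sink : sin (acos k) = `|s|.
  by rewrite sin_acos// -sqrtr_sqr -k2s2 addrC addKr.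
have kpi : acos k <= pi by rewrite acos_lepi.
have k0 : 0 <= acos k by rewrite acos_ge0.
have rotE t : cos t = k -> sin t = s -> Complex c d = Complex a b * rot t.
  rewrite /rot => -> ->.
  by congr Complex; rewrite -[LHS]mul1r -hu /k /s; ring.
have [s0|s0] := ger0P s.
  exists (acos k); rewrite ger0_norm//; split=> //.
  by apply: rotE; rewrite ?sink ?ger0_norm.
exists (- acos k); rewrite normrN ger0_norm//; split=> //.
by apply: rotE; rewrite ?cosN ?sinN// sink ltr0_norm// opprK.
Qed.

(** Angles are taken in one full turn, not in [[- pi, pi]], because they then
    grow in the order in which the points are met going around from [a]: the
    neighbours of [a] are the points with the smallest and the largest angle. *)
Lemma circle_dist_turn a u :
  exists t, [/\ val u = val a * rot t, 0 <= t < pi *+ 2 &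
    circle_dist a u = t \/ circle_dist a u = pi *+ 2 - t].
Proof.
have [t [ut -> tpi]] := circle_dist_arc a u.
have pi0 := pi_gt0 R.
have [t0|t0] := ger0P t.
  by exists t; move: tpi; rewrite ger0_norm// => tpi; split; [|lra|left].
exists (t + pi *+ 2); move: tpi; rewrite ltr0_norm// => tpi.
by split; [rewrite rotD2pi|lra|right; lra].
Qed.

(** Concavity of all the distances to points of [S], on the arc through [a]
    between the two neighbours of [a] in [S].  The weights are those of the
    barycentre [a] of [b] and [c] on this arc. *)
Lemma circle_dist_interpolation (S : seq (circle R)) a : S != [::] ->
  exists b c l, [/\ b \in S, c \in S, 0 <= l <= 1 &
    {in S, forall u,
      l * circle_dist b u + (1 - l) * circle_dist c u <= circle_dist a u}].
Proof.
move=> S0; have [ang angP] := choice (circle_dist_turn a).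
have [b bS bmin] := seq_argmin ang S0.
have [c cS cmax] := seq_argmin (fun u => - ang u) S0.
have [bE /andP[p0 p2] _] := angP b; have [cE /andP[q0 q2] _] := angP c.
set p := ang b in p0 p2 bE bmin; set q := ang c in q0 q2 cE cmax.
(* Measured from a, the points b and c are at the signed angles p and
   q - 2 pi, and the weight l balances them. *)
have [l l01 lE] := barycentric_weight p0 (etrans (subr_gt0 _ _) q2).
exists b, c, l; split=> // u uS; have [uE /andP[t0 t2] du] := angP u.
have pu := bmin u uS; have /= := cmax u uS; rewrite lerN2 => uq.
set t := ang u in uE t0 t2 du pu uq.
have dist_le v s r : val v = val a * rot s -> 0 <= r ->
    val a * rot (s + r) = val u \/ val a * rot (s - r) = val u ->
    circle_dist v u <= r.
  move=> vE r0 ru; rewrite -(ger0_norm r0).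
  case: ru => uvE; last rewrite -normrN.
    by apply: circle_dist_le_arc; rewrite vE -uvE rotD mulrA.
  by apply: circle_dist_le_arc; rewrite vE -uvE rotD mulrA.
have tC0 : 0 <= pi *+ 2 - t by rewrite subr_ge0 ltW.
have qC0 : 0 <= pi *+ 2 - q by rewrite subr_ge0 ltW.
(* From b and from c, go around to u in the direction of the arc that realizes
   d(a, u). *)
case: du => ->.
  apply: (barycentre_le l01 lE).
    apply: (dist_le _ _ _ bE); [by rewrite subr_ge0|left].
    by rewrite addrC subrK.
  apply: (dist_le _ _ _ cE); [exact: addr_ge0|left].
  by rewrite uE -[in RHS]rotD2pi; congr (_ * rot _); ring.
have lEN : l * - p = (1 - l) * - (pi *+ 2 - q) by rewrite !mulrN lE.
apply: (barycentre_le l01 lEN).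
  rewrite opprK; apply: (dist_le _ _ _ bE); [exact: addr_ge0|right].
  by rewrite uE -[in LHS]rotD2pi; congr (_ * rot _); ring.
have -> : pi *+ 2 - t - (pi *+ 2 - q) = q - t by ring.
apply: (dist_le _ _ _ cE); [by rewrite subr_ge0|right].
by rewrite opprB addrC subrK.
Qed.

End Arcs.

(** * Removing the values that are not data values *)

Section Reduction.
Set Implicit Arguments.
Unset Strict Implicit.
Variables (R : realType) (N : nat) (alpha : R) (w : 'I_N -> R).
Variable y : 'I_N -> circle R.
Hypotheses (alpha_ge0 : 0 <= alpha) (w_ge0 : forall n, 0 <= w n).
Implicit Types (x : 'I_N -> circle R) (a b : circle R) (l k : R).

Local Notation d := (@circle_dist R).

Lemma L1TV_mix_le l k x1 x2 x :
  (forall m n, l * d (x1 m) (x1 n) + k * d (x2 m) (x2 n) <= d (x m) (x n)) ->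
  (forall n, l * d (x1 n) (y n) + k * d (x2 n) (y n) <= d (x n) (y n)) ->
  l * L1TV alpha w y x1 + k * L1TV alpha w y x2 <= L1TV alpha w y x.
Proof.
move=> edges data; rewrite /L1TV !mulrDr addrACA !(mulrCA _ alpha) -mulrDr.
apply: lerD.
  rewrite ler_wpM2l// !mulr_sumr -big_split ler_sum//= => m _.
  by rewrite !mulr_sumr -big_split ler_sum// => n _; exact: edges.
rewrite !mulr_sumr -big_split ler_sum//= => n _.
by rewrite !(mulrCA _ (w n)) -mulrDr ler_wpM2l.
Qed.

Definition replace a b x : 'I_N -> circle R :=
  fun n => if x n == a then b else x n.

(** The entries equal to [a] have to move together: an edge between two of them
    has length zero and could otherwise grow.  An edge between one of them and
    an entry in [S], and a data term at one of them, do not increase on average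
    by the interpolation inequality. *)
Lemma L1TV_remove_value (S : seq (circle R)) a x : S != [::] ->
  (forall n, y n \in S) -> (forall n, x n \in a :: S) ->
  exists2 b, b \in S & L1TV alpha w y (replace a b x) <= L1TV alpha w y x.
Proof.
move=> S0 yS xS.
have [b [c [l [bS cS /andP[l0 l1] interp]]]] := circle_dist_interpolation a S0.
have mix : l * L1TV alpha w y (replace a b x)
    + (1 - l) * L1TV alpha w y (replace a c x) <= L1TV alpha w y x.
  have noop (r : R) : l * r + (1 - l) * r <= r.
    by rewrite -mulrDl addrC subrK mul1r.
  have xS' n : x n != a -> x n \in S.
    by move=> /negPf xna; have := xS n; rewrite inE xna.
  apply: L1TV_mix_le => [m n|n]; rewrite /replace; last first.
    by case: eqP => [->|_]; [exact: interp|exact: noop].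
  have [->|/xS' xm] := eqVneq (x m) a; have [->|/xS' xn] := eqVneq (x n) a.
  - by rewrite !circle_distxx noop.
  - exact: interp.
  - by rewrite !(circle_distC (x m)) interp.
  - exact: noop.
have : Num.min (L1TV alpha w y (replace a b x)) (L1TV alpha w y (replace a c x))
    <= L1TV alpha w y x.
  apply: le_trans mix; rewrite -[leLHS]mul1r -[in leLHS](subrKC l 1) mulrDl.
  by apply: lerD; rewrite ler_wpM2l ?subr_ge0// ge_min lexx ?orbT.
by rewrite ge_min => /orP[]; [exists b|exists c].
Qed.

Lemma L1TV_reduce_to_data x : (0 < N)%N ->
  exists f : {ffun 'I_N -> 'I_N},
    L1TV alpha w y (y \o f) <= L1TV alpha w y x.
Proof.
move=> N0; pose Y := [seq y n | n <- enum 'I_N].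
have yY n : y n \in Y by rewrite map_f ?mem_enum.
(* L lists the values that z may take besides the data.  It need not be sharp:
   a step that replaces one of them by another still shortens L. *)
have reduce L z : (forall n, z n \in L ++ Y) ->
    exists2 z', (forall n, z' n \in Y) & L1TV alpha w y z' <= L1TV alpha w y z.
  elim: L z => [|a L IH] z zL; first by exists z.
  have yLY n : y n \in L ++ Y by rewrite mem_cat yY orbT.
  have LY0 : L ++ Y != [::].
    by apply/eqP => LY; have := yLY (Ordinal N0); rewrite LY.
  have [b bLY bz] := L1TV_remove_value LY0 yLY zL.
  have [|z' z'Y z'b] := IH (replace a b z).
    move=> n; rewrite /replace; case: eqVneq => // /negPf zna.
    by have := zL n; rewrite inE zna.
  by exists z' => //; exact: le_trans bz.
have [|z zY zx] := reduce [seq x n | n <- enum 'I_N] x.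
  by move=> n; rewrite mem_cat map_f ?mem_enum.
have /choice[f fE] n : exists j, z n = y j.
  by have /mapP[j _ ->] := zY n; exists j.
exists (finfun f); suff -> : y \o finfun f = z by [].
by apply/funext => n; rewrite /= ffunE fE.
Qed.

End Reduction.

Theorem theorem2 (R : realType) (N : nat) (alpha : R) (w : 'I_N -> R)
    (y : 'I_N -> circle R) (hN : (1 <= N)%N) (halpha : 0 < alpha)
    (hw : forall n : 'I_N, 0 <= w n) :
  let V : set (circle R) := Val y `|` Val (fun n : 'I_N => antipode (y n)) in
  exists m : R,
    is_min [set: 'I_N -> circle R] (L1TV alpha w y) m /\
    is_min [set x : 'I_N -> circle R | forall n : 'I_N, V (x n)]
      (L1TV alpha w y) m.
Proof.
move=> V.
have F0 : enum {ffun 'I_N -> 'I_N} != [::].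
  by apply/eqP => F; have := mem_enum predT [ffun n : 'I_N => n]; rewrite F.
have [f _ fmin] :=
  seq_argmin (fun g : {ffun 'I_N -> 'I_N} => L1TV alpha w y (y \o g)) F0.
have lb x : L1TV alpha w y (y \o f) <= L1TV alpha w y x.
  have [g gx] := L1TV_reduce_to_data y (ltW halpha) hw x hN.
  by apply: le_trans gx; apply: fmin; rewrite mem_enum.
exists (L1TV alpha w y (y \o f)); split; split.
- by exists (y \o f).
- by move=> _ [x _ <-].
- by exists (y \o f) => // n; left; exists (f n).
- by move=> _ [x _ <-].
Qed.
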